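(* Let $F$ be the cumulative distribution function of an arbitrary probability distribution on $[0,1]$. Let $(c_n)_{n\ge 0}$ be i.i.d. random variables with cumulative distribution function $F$, independent of the random variable $r_0$ with values in $[0,1]$, and define $r_{n+1}=T(c_n,r_n)$ for $n\ge 0$, with $T$ the rescaling map given in the context. If $r_0\sim\mathcal{U}(0,1)$, then $r_n\sim\mathcal{U}(0,1)$ for all $n\ge 1$; that is, $\mathcal{U}(0,1)$ is a stationary distribution for the process $(r_n)_{n\ge 0}$.
   Context: $\mathcal{U}(0,1)$ denotes the uniform distribution on $(0,1)$. For $c,r\in[0,1]$ the rescaling map is $$T(c,r)=\begin{cases}\dfrac{r}{c} & \text{if } c\ge r,\\[2mm] \dfrac{r-c}{1-c} & \text{if } c<r,\end{cases}$$ with the convention $T(0,0)=0$. The process models the bisection method with random cuts: $r_n$ is the relative position of the root in the current interval (rescaled to $[0,1]$), $c_n$ is the relative position of the cut, and the subinterval containing the root is kept and rescaled to $[0,1]$. *)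

(* Defs.v *)
From HB Require Import structures.
From mathcomp Require Import all_boot all_order all_algebra.
From mathcomp Require Import all_classical all_reals all_analysis measurable_realfun.

Set Implicit Arguments.
Unset Strict Implicit.
Unset Printing Implicit Defensive.

Import Order.TTheory GRing.Theory Num.Theory.
Import numFieldNormedType.Exports.

Local Open Scope classical_set_scope.
Local Open Scope ring_scope.

(* The rescaling map is meant for c, r in [0, 1]; outside the unit square it is
   the total function given by the same formulas. *)
Definition rescale (R : realType) (c r : R) : R :=
  if (c == 0) && (r == 0) then 0
  else if r <= c then r / c
  else (r - c) / (1 - c).

Section measurability.
Context (R : realType).

Lemma measurable_invr : measurable_fun [set: R] (fun x : R => x^-1).
Proof.
rewrite -(setvU [set (0 : R)]).
apply/measurable_funU => //; first exact: measurableC.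
split; last exact: measurable_fun_set1.
apply: open_continuous_measurable_fun.
  by apply: closed_openC; exact: closed_eq.
by move=> x; rewrite inE => /eqP x0; exact: inv_continuous.
Qed.

Lemma measurable_rescale d (Omega : measurableType d) (c r : Omega -> R) :
  measurable_fun setT c -> measurable_fun setT r ->
  measurable_fun setT (fun w => rescale (c w) (r w)).
Proof.
move=> mc mr; apply: measurable_fun_ifT.
- by apply: measurable_and; apply: measurable_fun_eqr => //; exact: measurable_cst.
- exact: measurable_cst.
- apply: measurable_fun_ifT.
  + exact: measurable_fun_ler.
  + apply: measurable_funM => //; exact: measurableT_comp measurable_invr mc.
  + apply: measurable_funM; first exact: measurable_funB.
    apply: measurableT_comp measurable_invr _.
    by apply: measurable_funB => //; exact: measurable_cst.
Qed.

End measurability.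

Section process.
Context (R : realType) (d : measure_display) (Omega : measurableType d)
  (P : probability Omega R).

Fixpoint bisection_process (c : nat -> {RV P >-> R}) (r0 : {RV P >-> R})
    (n : nat) : Omega -> R :=
  if n is m.+1 then fun w => rescale (c m w) (bisection_process c r0 m w)
  else r0.

Lemma measurable_bisection_process (c : nat -> {RV P >-> R})
    (r0 : {RV P >-> R}) (n : nat) :
  measurable_fun setT (bisection_process c r0 n).
Proof.
elim: n => [|n IHn] /=; first exact: measurable_funPT.
exact: measurable_rescale (@measurable_funPT _ _ _ _ (c n)) IHn.
Qed.

HB.instance Definition _ (c : nat -> {RV P >-> R}) (r0 : {RV P >-> R})
    (n : nat) :=
  isMeasurableFun.Build _ _ _ _ (bisection_process c r0 n)
    (measurable_bisection_process c r0 n).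

(* Laws are compared on measurable sets only: a measure is a function on all
   sets, whose values outside the sigma-algebra are irrelevant. *)
Definition has_law (X : {RV P >-> R}) (mu : set R -> \bar R) : Prop :=
  forall A : set R, measurable A -> distribution P X A = mu A.

Definition mutually_independent (X : nat -> {RV P >-> R}) : Prop :=
  forall (J : seq nat) (A : nat -> set R),
    uniq J -> (forall i, measurable (A i)) ->
    P (\bigcap_(i in [set` J]) (X i @^-1` A i)) =
      (\prod_(i <- J) P (X i @^-1` A i))%E.

Definition sigma_generated (X : nat -> {RV P >-> R}) : set (set Omega) :=
  <<s \bigcup_n preimage_set_system setT (X n) measurable >>.

Definition independent_of_sequence (Y : {RV P >-> R})
    (X : nat -> {RV P >-> R}) : Prop :=
  forall (A : set R) (E : set Omega),
    measurable A -> sigma_generated X E ->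
    P ((Y @^-1` A) `&` E) = (P (Y @^-1` A) * P E)%E.

Definition iid_with_cdf (X : nat -> {RV P >-> R}) (F : R -> R) : Prop :=
  mutually_independent X /\ forall n x, cdf (X n) x = (F x)%:E.

End process.

Definition cdf_on_unit_interval (R : realType) (F : R -> R) : Prop :=
  exists mu : probability R R,
    mu `[0, 1]%classic = 1%E /\ forall x, (F x)%:E = mu `]-oo, x]%classic.

Arguments has_law [R d Omega] P X mu.
Arguments mutually_independent [R d Omega] P X.
Arguments independent_of_sequence [R d Omega] P Y X.
Arguments iid_with_cdf [R d Omega] P X F.

(* Main.v *)
Require Import Defs.
From mathcomp Require Import all_boot all_order all_algebra.
From mathcomp Require Import all_classical all_reals all_analysis.
From HB Require Import structures.
From mathcomp Require Import measurable_realfun ring.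

Import Order.TTheory GRing.Theory Num.Theory.
Local Open Scope classical_set_scope.
Local Open Scope ring_scope.

(** For a fixed cut [c] in [0, 1], the map [rescale c] preserves the uniform
    law: it stretches [0, c] and ]c, 1] affinely onto the unit interval, so the
    points of [0, 1] sent below [t] form two intervals of lengths [c * t] and
    [(1 - c) * t], of total length [t] ([uniform_rescale]).

    A random cut that is independent of the current position may be treated as
    fixed, by Fubini. To iterate this, the invariant carried along the process
    is stronger than uniformity: [r_n] is uniform and independent of the whole
    sigma-algebra generated by all the cuts, past ones included. It survives a
    step because, for an event [E] of that sigma-algebra, the restriction of the
    joint law of [(c_n, r_n)] to [E] is the product of the restricted law of
    [c_n] with the uniform law, and for almost every value of [c_n] the map
    [rescale c_n] leaves the second factor unchanged
    ([law_independent_of_random_map]). Conditionally on all the cuts, [r_n] is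
    thus the image of a uniform variable under a composition of
    measure-preserving maps. *)

(** * Probabilities on the line with the same distribution function *)

(** The half-open intervals ]a, b] are stable under intersection and generate
    the Borel sets, and their mass is a difference of two values of the
    distribution function. *)
Lemma probability_eq_of_cdf {R : realType} (mu nu : probability R R) :
  (forall x, mu `]-oo, x]%classic = nu `]-oo, x]%classic) ->
  forall A, measurable A -> mu A = nu A.
Proof.
move=> cdfE A mA.
apply: (@measure_unique _ R R (@ocitv R)
  (fun k : nat => `]-(k%:R), k%:R]%classic) _ _ _ _ mu nu) => //.
- exact: ocitvI.
- by move=> k; exact: is_ocitv.
- apply/seteqP; split => // x _; exists (Num.bound `|x|) => //=.
  have := archi_boundP (normr_ge0 x).
  by rewrite in_itv/= ltr_norml => /andP[-> /ltW].
- move=> _ [[a b] _ <-] /=.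
  have [ab|ba] := leP a b; last first.
    by rewrite set_itv_ge ?measure0// bnd_simp -leNgt ltW.
  have -> : `]a, b]%classic = `]-oo, b] `\` `]-oo, a].
    apply/seteqP; split => x /=; rewrite !in_itv/=.
      by move=> /andP[ax xb]; split => //; apply/negP; rewrite -ltNge.
    by move=> [-> /negP]; rewrite -ltNge => ->.
  rewrite !measureD//; last 2 first.
  - by rewrite (le_lt_trans (probability_le1 _ _)) ?ltry.
  - by rewrite (le_lt_trans (probability_le1 _ _)) ?ltry.
  rewrite (_ : `]-oo, b] `&` `]-oo, a] = `]-oo, a]%classic); last first.
    by apply: setIidr => x /=; rewrite !in_itv/= => xa; exact: le_trans ab.
  by congr (_ - _)%E; exact: cdfE.
- by move=> k; rewrite (le_lt_trans (probability_le1 _ _)) ?ltry.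
Qed.

(** * The rescaling map preserves the uniform law *)

Lemma rescale_le1 {R : realType} (c r : R) :
  0 <= c -> 0 <= r <= 1 -> rescale c r <= 1.
Proof.
move=> c0 /andP[r0 r1]; rewrite /rescale; case: ifPn => [_|]; first exact: ler01.
rewrite negb_and => cr0; have [rc|cr] := leP r c.
  have cgt0 : 0 < c.
    rewrite lt_neqAle eq_sym c0 andbT; case/orP: cr0 => // rN0.
    by rewrite gt_eqF// (lt_le_trans _ rc)// lt_neqAle eq_sym rN0.
  by rewrite ler_pdivrMr// mul1r.
by rewrite ler_pdivrMr ?mul1r ?lerB// subr_gt0 (lt_le_trans cr r1).
Qed.

(** The bound [t < 1] keeps the two intervals on their own sides of the cut:
    then [c * t] is at most [c]. *)
Lemma rescale_le {R : realType} (c r t : R) :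
  0 <= c <= 1 -> 0 <= r <= 1 -> t < 1 ->
  (rescale c r <= t) = (0 <= t) && ((r <= c * t) || (c < r <= c + (1 - c) * t)).
Proof.
move=> /andP[c0 c1] /andP[r0 r1] t1; rewrite /rescale.
have [->|cN0] := eqVneq c 0; have [->|rN0] := eqVneq r 0 => //=.
- by rewrite mul0r lexx/= andbT.
- have rgt0 : 0 < r by rewrite lt_neqAle eq_sym rN0.
  rewrite leNgt rgt0 /= !subr0 divr1 mul0r add0r mul1r leNgt rgt0 /=.
  have [rt|//] := leP r t; last by rewrite andbF.
  by rewrite (le_trans r0 rt).
- have cgt0 : 0 < c by rewrite lt_neqAle eq_sym cN0.
  rewrite c0 mul0r ltNge c0 /= orbF pmulr_rge0//; exact: (esym (andbb _)).
- have cgt0 : 0 < c by rewrite lt_neqAle eq_sym cN0.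
  have [rc|cr] := leP r c => /=.
    rewrite orbF ler_pdivrMr// mulrC.
    have [rct|//] := leP r (c * t); last by rewrite andbF.
    by rewrite -(pmulr_rge0 t cgt0) (le_trans r0 rct).
  have c1' : 0 < 1 - c by rewrite subr_gt0 (lt_le_trans cr r1).
  rewrite ler_pdivrMr// lerBlDl [t * _]mulrC.
  have -> : (r <= c * t) = false.
    apply/negbTE; rewrite -ltNge (le_lt_trans _ cr)//.
    by rewrite -[leRHS]mulr1 ler_wpM2l// ltW.
  have [rct /=|] := leP r (c + (1 - c) * t); last by rewrite andbF.
  apply/esym; rewrite andbT -(pmulr_rge0 t c1'); have := lt_le_trans cr rct.
  by rewrite -ltrBlDl subrr => /ltW.
Qed.

Section uniform.
Context {R : realType}.

(** [uniform_prob] is a measure on the copy of [R] that carries the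
    sigma-algebra generated by half-open intervals; this copy of it is a
    measure on [R] itself, where random variables take their values. *)
Definition uniform01 : set R -> \bar R := uniform_prob (@ltr01 R).

Let uniform01_0 : uniform01 set0 = 0%E. Proof. exact: measure0. Qed.

Let uniform01_ge0 A : (0 <= uniform01 A)%E. Proof. exact: measure_ge0. Qed.

Let uniform01_sigma_additive : semi_sigma_additive uniform01.
Proof.
exact: (@measure_semi_sigma_additive _ (measurableTypeR R) _
  (uniform_prob (@ltr01 R))).
Qed.

HB.instance Definition _ := isMeasure.Build _ _ _ uniform01
  uniform01_0 uniform01_ge0 uniform01_sigma_additive.

Let uniform01_setT : uniform01 setT = 1%E.
Proof. exact: probability_setT. Qed.

HB.instance Definition _ := Measure_isProbability.Build _ _ R
  uniform01 uniform01_setT.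

Lemma uniform01E (A : set R) : measurable A ->
  uniform01 A = lebesgue_measure (A `&` `[0, 1]).
Proof.
move=> mA; rewrite /uniform01 /uniform_prob integral_uniform_pdf.
rewrite (eq_integral (cst 1%E)); last first.
  move=> x; rewrite inE/= in_itv/= => -[_ x01].
  by rewrite /uniform_pdf x01 subr0 invr1.
by rewrite integral_cst ?mul1e//; exact: measurableI.
Qed.

Lemma measurable_rescale_cut (c : R) : measurable_fun setT (rescale c).
Proof. by apply: measurable_rescale => //; exact: measurable_cst. Qed.

HB.instance Definition _ (c : R) :=
  isMeasurableFun.Build _ _ _ _ (rescale c) (measurable_rescale_cut c).

Lemma uniform_rescale (c : R) : 0 <= c <= 1 ->
  forall A, measurable A -> uniform01 (rescale c @^-1` A) = uniform01 A.
Proof.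
move=> c01.
apply: (probability_eq_of_cdf (distribution uniform01 (rescale c)) uniform01) => t.
have mT : measurable (rescale c @^-1` `]-oo, t]).
  by rewrite -[X in measurable X]setTI; exact: measurable_rescale_cut.
rewrite /distribution /pushforward /= !uniform01E//.
have [c0 c1] := andP c01.
(* Outside [0, 1[ the distribution function is constant: both sets meet [0, 1]
   in all of it when 1 <= t, and in nothing when t < 0. *)
have [t1|t1] := leP 1 t.
  congr (lebesgue_measure _); apply/seteqP.
  split => x /=; rewrite !in_itv/= => -[_ x01]; split => //.
    by case/andP: x01 => _ x1; exact: le_trans x1 t1.
  by rewrite (le_trans _ t1)// rescale_le1.
have [t0|t0] := ltP t 0.
  congr (lebesgue_measure _); apply/seteqP.
  split => x /=; rewrite !in_itv/= => -[xt x01].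
    by move: xt; rewrite rescale_le// leNgt t0.
  case/andP: x01 => x0 _.
  by move: (le_lt_trans (le_trans x0 xt) t0); rewrite ltxx.
have ctc : c * t <= c by rewrite -[leRHS]mulr1 ler_wpM2l// ltW.
have c1c : (1 - c) * t <= 1 - c.
  by rewrite -[leRHS]mulr1 ler_wpM2l ?subr_ge0// ltW.
have -> : rescale c @^-1` `]-oo, t] `&` `[0, 1] =
    `[0, c * t] `|` `]c, c + (1 - c) * t].
  apply/seteqP; split => x /=; rewrite !in_itv/=.
    move=> [+ x01]; rewrite rescale_le// t0 /=.
    by case/andP: (x01) => -> _ /orP[->|->]; [left|right].
  move=> xU; have x01 : 0 <= x <= 1.
    case: xU => /andP[].
      by move=> -> xct /=; rewrite (le_trans xct)// (le_trans ctc).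
    move=> cx xc; rewrite (le_trans c0 (ltW cx))/= (le_trans xc)//.
    by rewrite -lerBrDl.
  split=> //; rewrite rescale_le// t0/=.
  by case: xU => [/andP[_ ->]|->]; rewrite ?orbT.
rewrite measureU//; last first.
  apply/seteqP; split => x //=; rewrite !in_itv/= => -[/andP[_ xct] /andP[cx _]].
  by move: (lt_le_trans cx (le_trans xct ctc)); rewrite ltxx.
have -> : `]-oo, t] `&` `[0, 1] = `[0, t]%classic.
  apply/seteqP; split => x /=; rewrite !in_itv/=.
    by move=> [-> /andP[->]].
  by move=> /andP[-> xt]; rewrite xt (le_trans xt (ltW t1)).
have leb (b : bool) (x y : R) : x <= y ->
    lebesgue_measure [set` Interval (BSide b x) (BRight y)] = (y - x)%:E.
  rewrite lebesgue_measure_itv/= lte_fin le_eqVlt => /orP[/eqP ->|->//].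
  by rewrite ltxx subrr.
rewrite leb// subr0.
transitivity ((c * t - 0)%:E + (c + (1 - c) * t - c)%:E)%E.
  congr (_ + _)%E; apply: leb; first exact: mulr_ge0.
  by rewrite lerDl mulr_ge0// subr_ge0.
by rewrite -EFinD; congr EFin; ring.
Qed.

End uniform.

(** * Applying an independent random measure-preserving map *)

Section law_on.
Local Open Scope ereal_scope.
Context d (Omega : measurableType d) d' (S : measurableType d') (R : realType)
  (P : probability Omega R).
Variables (E : set Omega) (mE : measurable E) (Y : {mfun Omega >-> S}).

(** Not normalised by [P E], so that events of probability zero need no
    separate treatment. *)
Definition law_on := pushforward (mrestr P mE) Y.

Let law_on0 : law_on set0 = 0. Proof. exact: measure0. Qed.

Let law_on_ge0 B : 0 <= law_on B. Proof. exact: measure_ge0. Qed.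

Let law_on_sigma_additive : semi_sigma_additive law_on.
Proof. exact: measure_semi_sigma_additive. Qed.

HB.instance Definition _ := isMeasure.Build _ _ _ law_on
  law_on0 law_on_ge0 law_on_sigma_additive.

Let law_on_fin : fin_num_fun law_on.
Proof.
move=> B mB; rewrite ge0_fin_numE ?measure_ge0//.
rewrite (@le_lt_trans _ _ 1) ?ltry// probability_le1//; apply: measurableI => //.
by rewrite -[X in measurable X]setTI; exact: measurable_funPT.
Qed.

HB.instance Definition _ := Measure_isFinite.Build _ _ _ law_on law_on_fin.

End law_on.
Arguments law_on {d Omega d' S R} P {E} mE Y.

Section random_map.
Local Open Scope ereal_scope.
Context d (Omega : measurableType d) d1 (S : measurableType d1)
  d2 (T : measurableType d2) (R : realType) (P : probability Omega R).

Definition law_independent_of (X : Omega -> T) (mu : set T -> \bar R)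
    (G : set (set Omega)) :=
  forall A E, measurable A -> G E -> P (X @^-1` A `&` E) = mu A * P E.

(** Restricted to an event [E] of [G], the pair [(C, X)] has a product law,
    since [E] cut by an event about [C] is again in [G]. Integrating first over
    [X], at a fixed value [s] of [C], replaces [f (s, _)] by the identity for
    almost every [s]. *)
Lemma law_independent_of_random_map (mu : probability T R)
    (f : S * T -> T) (D : set S) (C : {mfun Omega >-> S})
    (X : {mfun Omega >-> T}) (G : set (set Omega)) :
  measurable_fun setT f -> measurable D ->
  (forall s, D s ->
    forall A, measurable A -> mu ((fun x => f (s, x)) @^-1` A) = mu A) ->
  setI_closed G -> G `<=` measurable ->
  (forall B, measurable B -> G (C @^-1` B)) -> P (C @^-1` D) = 1 ->
  law_independent_of X mu G ->
  law_independent_of (fun w => f (C w, X w)) mu G.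
Proof.
move=> mf mD fmu GI Gm GC PD1 XG A E mA GE.
have mE := Gm _ GE.
have mC B : measurable B -> measurable (C @^-1` B).
  by move=> mB; rewrite -[X in measurable X]setTI; exact: measurable_funPT.
have mCX : measurable_fun setT (fun w => (C w, X w)).
  by apply: measurable_fun_pair.
pose CX : {mfun Omega >-> (S * T)%type} :=
  HB.pack (fun w => (C w, X w)) (isMeasurableFun.Build _ _ _ _ _ mCX).
rewrite -[LHS]/(law_on P mE CX (f @^-1` A)).
have mfA : measurable (f @^-1` A).
  by rewrite -[X in measurable X]setTI; exact: mf.
rewrite -(@product_measure_unique _ _ _ _ _ (law_on P mE C) mu)//; last first.
  move=> B A' mB mA'; rewrite muleC /law_on /pushforward /mrestr.
  by rewrite -XG//; [rewrite setICA setIA|exact/GI/GE/GC].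
have law0 : law_on P mE C (~` D) = 0.
  have PCD0 : P (C @^-1` ~` D) = 0.
    by rewrite preimage_setC probability_setC ?PD1 ?subee//; exact: mC.
  apply/eqP; rewrite -measure_le0 -PCD0 /law_on /pushforward /mrestr.
  by apply: measureIl => //; apply: mC; exact: measurableC.
transitivity (\int[law_on P mE C]_(s in D) mu A).
  rewrite /product_measure1 (ge0_negligible_integral _ _ _ _ law0)//; last 2 first.
  - exact: measurableC.
  - exact: measurable_fun_xsection.
  rewrite setTD setCK; apply: eq_integral => s /[!inE] Ds /=; rewrite xsectionE.
  exact: fmu.
rewrite integral_cst//; congr (_ * _).
rewrite -[LHS]adde0 -[X in _ + X]law0 -measureU ?setICr//; last exact: measurableC.
by rewrite setUv -[LHS]/(P (C @^-1` setT `&` E)) preimage_setT setTI.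
Qed.

End random_map.
Arguments law_independent_of {d Omega d2 T R} P X mu G.

(** * Stationarity *)

Theorem proposition3 (R : realType) (d : measure_display)
    (Omega : measurableType d) (P : probability Omega R)
    (F : R -> R) (c : nat -> {RV P >-> R}) (r0 : {RV P >-> R})
    (F_cdf : cdf_on_unit_interval F)
    (c_iid : iid_with_cdf P c F)
    (r0_indep : independent_of_sequence P r0 c)
    (r0_01 : forall w, 0 <= r0 w <= 1)
    (r0_unif : has_law P r0 (uniform_prob (@ltr01 R))) :
  forall n, (1 <= n)%N ->
    has_law P (bisection_process c r0 n) (uniform_prob (@ltr01 R)).
Proof.
have [_ c_cdf] := c_iid; have [mu [mu01 mu_cdf]] := F_cdf.
have Pc01 n : P (c n @^-1` `[0, 1]) = 1%E.
  rewrite -mu01; apply: (probability_eq_of_cdf (distribution P (c n)) mu) => //.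
  by move=> x; rewrite -mu_cdf; exact: c_cdf.
pose cuts := g_sigma_algebraType
  (\bigcup_n preimage_set_system setT (c n) measurable).
have unif_indep n : law_independent_of P (bisection_process c r0 n) uniform01
    (sigma_generated c).
  elim: n => [|n IH] /=.
    by move=> A E mA GE; rewrite r0_indep//; congr (_ * _)%E; exact: r0_unif.
  apply: (@law_independent_of_random_map _ _ _ _ _ _ _ _ uniform01
     (fun p => rescale p.1 p.2) `[0, 1]%classic (c n)
     (bisection_process c r0 n)) => //.
  - exact: measurable_rescale.
  - by move=> s; rewrite /= in_itv/= => s01 A mA; exact: uniform_rescale.
  - by move=> A B; exact: (@measurableI _ cuts).
  - apply: smallest_sub; first exact: sigma_algebra_measurable.
    by move=> _ [k _ [B mB <-]]; exact: measurable_funP.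
  - move=> B mB; apply: sub_sigma_algebra; exists n => //; exists B => //.
    exact: setTI.
move=> n _ A mA; rewrite -[LHS]/(P (bisection_process c r0 n @^-1` A)).
rewrite -[X in P X]setIT unif_indep// ?probability_setT ?mule1//.
exact: (@measurableT _ cuts).
Qed.
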